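(* Let $G$ be an infinite finitely generated group with decidable subgroup membership problem. Then, for every $k\geq 2$, $k\text{-}\mathrm{SAT}(G)\leq_m \mathrm{DP}(G)$.
   Context: Let $S$ be a finite generating set of $G$; a word $w\in(S\cup S^{-1})^*$ evaluates to an element $\bar w\in G$. Subgroup membership problem of $G$: given words $u,w_1,\dots,w_n\in (S\cup S^{-1})^*$, determine whether $\bar u\in\langle \bar w_1,\dots,\bar w_n\rangle$. $k$-SAT over $G$ ($k>1$): Boolean variables are the elements of $G$; for $g\in G$, $g'$ denotes either the literal $g$ or its negation $\neg g$. An input formula is $\phi=\bigwedge_{i=1}^m (v_{i1}'\vee\dots\vee v_{ik}')$ with $v_{ij}\in (S\cup S^{-1})^*$, where each $'$ indicates a fixed choice of negated or non-negated; its evaluation is $\bar\phi=\bigwedge_{i=1}^m (\bar v_{i1}'\vee\dots\vee \bar v_{ik}')$. For $h\in G$, $\bar\phi(h)$ is obtained from $\bar\phi$ by left-multiplying every variable by $h$ (with the same negations). The problem $k\text{-}\mathrm{SAT}(G)$ is: given an input formula $\phi$ and words $w_1,\dots,w_n\in(S\cup S^{-1})^*$, determine whether $\bigwedge_{h\in H}\bar\phi(h)$ is satisfiable, where $H=\langle \bar w_1,\dots,\bar w_n\rangle$; that is, whether there is an assignment $\alpha:G\to\{0,1\}$ making every clause of $\bar\phi(h)$ true for every $h\in H$. (The choice of $S$ is immaterial, since inputs can be computably rewritten in another generating set.) Domino problem: for a finite alphabet $A$, a nearest neighbor pattern is a tuple $(a,b,s)$ with $a,b\in A$, $s\in S$;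 it appears in $x\in A^G$ if there is $g\in G$ with $x(g)=a$ and $x(gs)=b$. For a finite set $\mathcal F$ of such patterns, $X_{\mathcal F}\subseteq A^G$ is the set of configurations in which no pattern of $\mathcal F$ appears. $\mathrm{DP}(G,S)$: given $A$ and $\mathcal F$, determine whether $X_{\mathcal F}$ is non-empty (yes instances are those with $X_{\mathcal F}\ne\emptyset$). It is known that $\mathrm{DP}(G,S_1)$ and $\mathrm{DP}(G,S_2)$ are many-one equivalent for all finite generating sets $S_1,S_2$, so one writes $\mathrm{DP}(G)$. $L\leq_m L'$ (many-one reduction) means there is a computable function $f$ with $w\in L\iff f(w)\in L'$ for every $w$; problems are identified with their languages of yes instances. *)

(* Defs.v *)
From HB Require Import structures.
From mathcomp Require Import all_boot.
From mathcomp Require Import classical_sets cardinality.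

Set Implicit Arguments.
Unset Strict Implicit.
Unset Printing Implicit Defensive.

Local Open Scope classical_set_scope.
Local Open Scope group_scope.

(** Computability *)

(* The total recursive functions of any arity (Kleene): the closure of the
   initial functions under composition, primitive recursion and minimization
   of regular functions.  The last two constructors take the function being
   defined as an argument, together with its defining equations, so the class
   is closed under pointwise equality. *)
Inductive recursive : forall n : nat, (n.-tuple nat -> nat) -> Prop :=
| recursive_zero : recursive (fun _ : 0.-tuple nat => 0)
| recursive_succ : recursive (fun v : 1.-tuple nat => (tnth v ord0).+1)
| recursive_proj n (i : 'I_n) : recursive (fun v : n.-tuple nat => tnth v i)
| recursive_comp m n (f : m.-tuple nat -> nat)
      (g : 'I_m -> n.-tuple nat -> nat) :
    recursive f -> (forall i, recursive (g i)) ->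
    recursive (fun v : n.-tuple nat => f [tuple g i v | i < m])
| recursive_primrec n (f : n.-tuple nat -> nat) (g : n.+2.-tuple nat -> nat)
      (h : n.+1.-tuple nat -> nat) :
    recursive f -> recursive g ->
    (forall v : n.-tuple nat, h [tuple of 0 :: v] = f v) ->
    (forall (y : nat) (v : n.-tuple nat),
       h [tuple of y.+1 :: v] = g [tuple of y :: h [tuple of y :: v] :: v]) ->
    recursive h
| recursive_mu n (f : n.+1.-tuple nat -> nat) (h : n.-tuple nat -> nat) :
    recursive f ->
    (forall v : n.-tuple nat, f [tuple of h v :: v] = 0) ->
    (forall (v : n.-tuple nat) (y : nat), (y < h v)%N ->
       f [tuple of y :: v] <> 0) ->
    recursive h.

(* Data are coded by [pickle].  A [countType] may carry any injection into
   [nat]; this notion is used below only for types built from [nat], [bool],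
   ['I_n], products, sequences, tuples and tagged sums, whose library codings
   are the usual explicit effective ones. *)
Definition computable (T U : countType) (f : T -> U) : Prop :=
  exists2 F : 1.-tuple nat -> nat, recursive F &
    forall x : T, F [tuple pickle x] = pickle (f x).

(* A problem is identified with its set of yes instances. *)
Definition decidable_problem (T : countType) (L : set T) : Prop :=
  exists2 f : T -> bool, computable f & forall x, L x <-> f x.

Definition many_one (T U : countType) (L : set T) (L' : set U) : Prop :=
  exists2 f : T -> U, computable f & forall x, L x <-> L' (f x).

(** Groups and words *)

Definition is_subgroup (G : groupType) (K : set G) : Prop :=
  [/\ K 1, forall x y, K x -> K y -> K (x * y) & forall x, K x -> K x^-1].

Definition generated (G : groupType) (X : set G) : set G :=
  smallest (@is_subgroup G) X.

(* A finite set S of group elements is given by an enumeration; the letter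
   [(i, false)] stands for the i-th element of S, [(i, true)] for its
   inverse. *)
Definition generating (G : groupType) n (S : n.-tuple G) : Prop :=
  generated [set x | x \in S] = [set: G].

Definition word (n : nat) : Type := seq ('I_n * bool).

Definition eval_letter (G : groupType) n (S : n.-tuple G)
    (l : 'I_n * bool) : G :=
  if l.2 then (tnth S l.1)^-1 else tnth S l.1.

Definition eval_word (G : groupType) n (S : n.-tuple G) (w : word n) : G :=
  \prod_(l <- w) eval_letter S l.

Definition generated_by_words (G : groupType) n (S : n.-tuple G)
    (ws : seq (word n)) : set G :=
  generated [set x | x \in map (eval_word S) ws].

(** Subgroup membership problem *)

Definition subgroup_membership (G : groupType) n (S : n.-tuple G) :
    set (word n * seq (word n)) :=
  [set I | generated_by_words S I.2 (eval_word S I.1)].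

(** k-SAT over a group *)

(* Conjunctions of k-literal clauses; the literal [(true, v)] is v and
   [(false, v)] is its negation. *)
Definition formula (k : nat) (V : Type) : Type := seq (k.-tuple (bool * V)).

Definition map_formula k (V W : Type) (f : V -> W) (phi : formula k V) :
    formula k W :=
  [seq [tuple of [seq (l.1, f l.2) | l <- C]] | C : k.-tuple (bool * V) <- phi].

Definition translate (G : groupType) k (h : G) (phi : formula k G) :
    formula k G :=
  map_formula (fun v => h * v) phi.

Definition satisfies k (V : Type) (alpha : V -> bool) (phi : formula k V) :
    bool :=
  all (fun C : k.-tuple (bool * V) => has (fun l => alpha l.2 == l.1) C) phi.

Definition kSAT (G : groupType) (k : nat) n (S : n.-tuple G) :
    set (formula k (word n) * seq (word n)) :=
  [set I | exists alpha : G -> bool,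
     forall h, generated_by_words S I.2 h ->
       satisfies alpha (translate h (map_formula (eval_word S) I.1))].
Arguments kSAT {G} k {n} S.

(** Domino problem *)

(* The pattern [(a, b, i)] is the triple (a, b, s) with s the i-th element
   of S. *)
Definition appears (G : groupType) n (S : n.-tuple G) (A : finType)
    (p : A * A * 'I_n) (x : G -> A) : Prop :=
  exists g : G, x g = p.1.1 /\ x (g * tnth S p.2) = p.1.2.

Definition nn_shift (G : groupType) n (S : n.-tuple G) (A : finType)
    (F : seq (A * A * 'I_n)) : set (G -> A) :=
  [set x | forall p, p \in F -> ~ appears S p x].

(* An instance consists of the size a of the alphabet {0, ..., a - 1} and of
   a list of forbidden patterns over that alphabet. *)
Definition domino_instance (n : nat) : Type :=
  {a : nat & seq ('I_a * 'I_a * 'I_n)}.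

Definition domino (G : groupType) n (S : n.-tuple G) :
    set (domino_instance n) :=
  [set I | nn_shift S (tagged I) !=set0].

(* Main.v *)
(** Let H be the subgroup generated by the input words. A formula translated
    over H only speaks about the functions beta_v(h) := alpha(h v), one for each
    variable v of the formula; conversely such functions on H come from an
    assignment alpha iff beta_v(h) = beta_v'(h u) whenever the element
    u := v v'^-1 lies in H, and the membership oracle tells which pairs (v, v')
    these are. As the constraints only use right translations by elements of H,
    they are satisfiable on H iff they are satisfiable on all of G: copy a
    solution to every left coset of H.

    To turn them into nearest neighbour constraints, let the symbol at g store
    the bits beta_v(g u), called tracks, for the pairs of words (v, u) that
    occur: the tracks (v, l u) at g and (v, u) at g l agree, which is a nearest
    neighbour condition, and it makes the track (v, u) at g equal to the track
    (v, empty) at g u. All tracks are indexed by their codes, so no word problem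
    has to be solved on the computable side. *)

Require Import Defs.
From mathcomp Require Import all_boot.
From mathcomp Require Import boolp classical_sets cardinality.

Set Implicit Arguments.
Unset Strict Implicit.
Unset Printing Implicit Defensive.

Local Open Scope nat_scope.

(** * Recursive arithmetic on natural numbers *)

Definition recursive1 (f : nat -> nat) : Prop :=
  recursive (fun v : 1.-tuple nat => f (nth 0 v 0)).

Definition recursive2 (f : nat -> nat -> nat) : Prop :=
  recursive (fun v : 2.-tuple nat => f (nth 0 v 0) (nth 0 v 1)).

Lemma eq_recursive n (f g : n.-tuple nat -> nat) :
  f =1 g -> recursive f -> recursive g.
Proof. by move/funext=> ->. Qed.

Lemma recursive1_succ : recursive1 succn.
Proof.
by apply: eq_recursive recursive_succ => v; rewrite (tnth_nth 0).
Qed.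

Lemma recursive1_comp n (f : nat -> nat) (g : n.-tuple nat -> nat) :
  recursive1 f -> recursive g -> recursive (fun v => f (g v)).
Proof.
move=> rf rg; have := @recursive_comp 1 n _ (fun=> g) rf (fun=> rg).
by apply: eq_recursive => v; rewrite (nth_mktuple _ 0 ord0).
Qed.

Lemma recursive2_comp n (f : nat -> nat -> nat) (g h : n.-tuple nat -> nat) :
  recursive2 f -> recursive g -> recursive h ->
  recursive (fun v => f (g v) (h v)).
Proof.
move=> rf rg rh.
have rgh (i : 'I_2) : recursive (if i == ord0 then g else h) by case: ifP.
have := recursive_comp rf rgh.
apply: eq_recursive => v.
by rewrite (nth_mktuple _ 0 ord0) (nth_mktuple _ 0 (@Ordinal 2 1 isT)).
Qed.

Lemma recursive_const n c : recursive (fun _ : n.-tuple nat => c).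
Proof.
elim: c => [|c IH]; last exact: (recursive1_comp recursive1_succ IH).
have := @recursive_comp 0 n _ (fun=> fun=> 0) recursive_zero.
by apply; case.
Qed.

Lemma recursive_nth n i : recursive (fun v : n.-tuple nat => nth 0 v i).
Proof.
have [lt_in|le_ni] := ltnP i n.
  by apply: eq_recursive (recursive_proj (Ordinal lt_in)) => v; rewrite (tnth_nth 0).
by apply: eq_recursive (recursive_const n 0) => v; rewrite nth_default ?size_tuple.
Qed.

Lemma recursive1_primrec c (g : nat -> nat -> nat) (f : nat -> nat) :
  recursive2 g -> f 0 = c -> (forall y, f y.+1 = g y (f y)) -> recursive1 f.
Proof.
move=> rg f0 fS.
by apply: (recursive_primrec (recursive_const 0 c) rg) => [v|y v] /=.
Qed.

Lemma recursive2_primrec (z : nat -> nat) (g : 3.-tuple nat -> nat)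
    (f : nat -> nat -> nat) :
  recursive1 z -> recursive g -> (forall x, f 0 x = z x) ->
  (forall y x, f y.+1 x = g [tuple y; f y x; x]) -> recursive2 f.
Proof.
move=> rz rg f0 fS; apply: (recursive_primrec rz rg) => [v|y v] //=.
rewrite fS; congr g; apply/val_inj.
by case: v => [[|x [|]]].
Qed.

Lemma recursive2_iter (f : nat -> nat) :
  recursive1 f -> recursive2 (fun n x => iter n f x).
Proof.
move=> rf; apply: (@recursive2_primrec id (fun v => f (nth 0 v 1))) => //=.
- exact: recursive_nth.
- exact: (recursive1_comp rf (recursive_nth _ _)).
Qed.

Lemma recursive2_add : recursive2 addn.
Proof.
have := recursive2_iter recursive1_succ.
by apply: eq_recursive => v; rewrite iter_succn addnC.
Qed.

Lemma recursive2_mul : recursive2 muln.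
Proof.
apply: (@recursive2_primrec (fun=> 0) (fun v => nth 0 v 2 + nth 0 v 1)) => //=.
- exact: recursive_const.
- exact: (recursive2_comp recursive2_add (recursive_nth _ _) (recursive_nth _ _)).
Qed.

Lemma recursive1_double : recursive1 double.
Proof.
have := recursive2_comp recursive2_add (recursive_nth 1 0) (recursive_nth 1 0).
by apply: eq_recursive => v; rewrite addnn.
Qed.

Lemma recursive1_exp2 : recursive1 (expn 2).
Proof.
apply: (@recursive1_primrec 1 (fun _ x => x.*2)) => //.
- exact: (recursive1_comp recursive1_double (recursive_nth _ _)).
- by move=> y; rewrite expnS mul2n.
Qed.

Lemma recursive1_eq0 : recursive1 (fun n => n == 0).
Proof.
by apply: (@recursive1_primrec 1 (fun _ _ => 0)) => //; exact: recursive_const.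
Qed.

Lemma recursive1_odd : recursive1 odd.
Proof.
apply: (@recursive1_primrec 0 (fun _ x => x == 0)) => //.
- exact: (recursive1_comp recursive1_eq0 (recursive_nth _ _)).
- by move=> y /=; case: odd.
Qed.

Lemma recursive1_half : recursive1 half.
Proof.
apply: (@recursive1_primrec 0 (fun y x => odd y + x)) => //.
- apply: (recursive2_comp recursive2_add); last exact: recursive_nth.
  exact: (recursive1_comp recursive1_odd (recursive_nth _ _)).
- by move=> y /=; rewrite uphalf_half.
Qed.

Lemma recursive1_pred : recursive1 predn.
Proof.
by apply: (@recursive1_primrec 0 (fun y _ => y)) => //; exact: recursive_nth.
Qed.

(** * Encoding and decoding of sequences of numbers *)

(* [CodeSeq.code (n :: s)] is [ccons n (CodeSeq.code s)]. *)
Definition ccons n c := 2 ^ n * c.*2.+1.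

Lemma recursive2_ccons : recursive2 ccons.
Proof.
apply: (recursive2_comp recursive2_mul).
  exact: (recursive1_comp recursive1_exp2 (recursive_nth _ _)).
apply: (recursive1_comp recursive1_succ).
exact: (recursive1_comp recursive1_double (recursive_nth _ _)).
Qed.

Lemma iter_half_ccons n c i : i <= n -> iter i half (ccons n c) = ccons (n - i) c.
Proof.
elim: i => [|i IH] lt_in; first by rewrite subn0.
rewrite iterS IH ?(ltnW lt_in) //.
by rewrite -(subnSK lt_in) /ccons expnS -mulnA mul2n doubleK.
Qed.

Lemma ccons_gt0 n c : 0 < ccons n c.
Proof. by rewrite muln_gt0 expn_gt0. Qed.

Lemma odd_ccons n c : odd (ccons n c) = (n == 0).
Proof. by rewrite /ccons oddM oddX /= odd_double andbT orbF. Qed.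

Lemma code_ccons c : 0 < c -> exists n d, c = ccons n d.
Proof.
rewrite -[c]CodeSeq.decodeK; case: (CodeSeq.decode c) => //= n s _.
by exists n, (CodeSeq.code s).
Qed.

(** The head of a nonzero code is its 2-adic valuation. The disjunct [c == 0] lets the search stop
    at the code of the empty sequence too, so that minimization is regular. *)
Lemma chead_subproof c : exists i, (c == 0) || odd (iter i half c).
Proof.
have [->|] := posnP c; first by exists 0.
move=> /code_ccons[n [d ->]]; exists n.
by rewrite iter_half_ccons // subnn odd_ccons.
Qed.

Definition chead c := ex_minn (chead_subproof c).

Definition ctail c := half (iter (chead c) half c).

Lemma chead_ccons n c : chead (ccons n c) = n.
Proof.
rewrite /chead; case: ex_minnP => i; rewrite eqn0Ngt ccons_gt0 /= => oddi le_i.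
have le_in : i <= n.
  by apply: le_i; rewrite iter_half_ccons // subnn odd_ccons.
move: oddi; rewrite iter_half_ccons // odd_ccons subn_eq0 => le_ni.
by apply/eqP; rewrite eqn_leq le_in.
Qed.

Lemma ctail_ccons n c : ctail (ccons n c) = c.
Proof.
rewrite /ctail chead_ccons iter_half_ccons // subnn /ccons mul1n.
exact: (half_bit_double c true).
Qed.

Lemma recursive1_chead : recursive1 chead.
Proof.
pose f i c := (~~ ((c == 0) || odd (iter i half c)) : nat).
have rf : recursive2 f.
  rewrite (_ : f = fun i c => ((c == 0) + odd (iter i half c) == 0)%N :> nat); last first.
    by apply/funext=> i; apply/funext=> c; rewrite /f; case: (c == 0); case: odd.
  apply: (recursive1_comp recursive1_eq0).
  apply: (recursive2_comp recursive2_add).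
    exact: (recursive1_comp recursive1_eq0 (recursive_nth _ _)).
  apply: (recursive1_comp recursive1_odd).
  exact: (recursive2_iter recursive1_half).
apply: (recursive_mu rf) => [v|v y] /=; rewrite /f /chead; case: ex_minnP => i.
  by move=> ->.
by move=> _ le_i lt_yi; case: (boolP (_ || _)) => // /le_i; rewrite leqNgt lt_yi.
Qed.

Lemma recursive1_ctail : recursive1 ctail.
Proof.
apply: (recursive1_comp recursive1_half).
apply: (recursive2_comp (recursive2_iter recursive1_half)).
  exact: recursive1_chead.
exact: recursive_nth.
Qed.

(** * Computable functions on coded data *)

Lemma pickle_pair (T U : countType) (x : T) (y : U) :
  pickle (x, y) = ccons (pickle x) (ccons (pickle y) 0).
Proof. by []. Qed.

Lemma pickle_cons (T : countType) (x : T) (s : seq T) :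
  pickle (x :: s) = ccons (pickle x) (pickle s).
Proof. by []. Qed.

Lemma computable_recursive1 (T U : countType) (f : T -> U) (F : nat -> nat) :
  recursive1 F -> (forall x, F (pickle x) = pickle (f x)) -> computable f.
Proof. by move=> rF fF; exists (fun v => F (nth 0 v 0)). Qed.

Lemma computable_recursive1E (T U : countType) (f : T -> U) :
  computable f ->
  exists2 F, recursive1 F & forall x, F (pickle x) = pickle (f x).
Proof.
case=> F rF fF; exists (fun n => F [tuple n]) => //.
apply: eq_recursive rF => v; congr F; apply/val_inj.
by case: v => [[|x [|]]].
Qed.

(** Only codes matter, so values may change type freely: ordinals become numbers, tuples become
    sequences, tagged sums become pairs. *)
Lemma computable_samecode (E T U : countType) (f : E -> T) (g : E -> U) :
  (forall e, pickle (f e) = pickle (g e)) -> computable f -> computable g.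
Proof. by move=> fg [F rF fF]; exists F => // e; rewrite fF. Qed.

Lemma eq_computable (T U : countType) (f g : T -> U) :
  f =1 g -> computable f -> computable g.
Proof. by move=> fg; apply: computable_samecode => e; rewrite fg. Qed.

Lemma computable_id (T : countType) : computable (fun x : T => x).
Proof. exact: (@computable_recursive1 _ _ _ id (recursive_nth _ _)). Qed.

Lemma computable_const (T U : countType) (c : U) : computable (fun _ : T => c).
Proof. exact: (@computable_recursive1 _ _ _ (fun=> pickle c) (recursive_const _ _)). Qed.

Lemma computable_comp (E T U : countType) (g : T -> U) (f : E -> T) :
  computable g -> computable f -> computable (fun e => g (f e)).
Proof.
move=> /computable_recursive1E[G rG gG] /computable_recursive1E[F rF fF].
apply: (@computable_recursive1 _ _ _ (fun n => G (F n)) (recursive1_comp rG rF)) => x.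
by rewrite fF gG.
Qed.

Lemma computable_op (E T U V : countType) (op : T -> U -> V)
    (Op : nat -> nat -> nat)    (f : E -> T) (g : E -> U) :
  recursive2 Op -> (forall x y, Op (pickle x) (pickle y) = pickle (op x y)) ->
  computable f -> computable g -> computable (fun e => op (f e) (g e)).
Proof.
move=> rOp opE /computable_recursive1E[F rF fF] /computable_recursive1E[G rG gG].
apply: (@computable_recursive1 _ _ _ (fun n => Op (F n) (G n))
  (recursive2_comp rOp rF rG)) => x.
by rewrite fF gG opE.
Qed.

Lemma computable_pair (E T U : countType) (f : E -> T) (g : E -> U) :
  computable f -> computable g -> computable (fun e => (f e, g e)).
Proof.
apply: (@computable_op _ _ _ _ _ (fun n m => ccons n (ccons m 0))) => //.
apply: (recursive2_comp recursive2_ccons (recursive_nth _ _)).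
exact: (recursive2_comp recursive2_ccons (recursive_nth _ _) (recursive_const _ _)).
Qed.

Lemma computable_fst (E T U : countType) (f : E -> T * U) :
  computable f -> computable (fun e => (f e).1).
Proof.
apply: computable_comp; apply: (computable_recursive1 recursive1_chead).
by case=> x y; rewrite pickle_pair chead_ccons.
Qed.

Lemma computable_snd (E T U : countType) (f : E -> T * U) :
  computable f -> computable (fun e => (f e).2).
Proof.
apply: computable_comp.
apply: (@computable_recursive1 _ _ _ (fun n => chead (ctail n))
  (recursive1_comp recursive1_chead recursive1_ctail)).
by case=> x y; rewrite pickle_pair ctail_ccons chead_ccons.
Qed.

Lemma computable_cons (E T : countType) (f : E -> T) (g : E -> seq T) :
  computable f -> computable g -> computable (fun e => f e :: g e).
Proof. exact: (@computable_op _ _ _ _ _ _ _ _ recursive2_ccons). Qed.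

(** Both branches are total, so selection is arithmetic: the sum of the branches, each multiplied by
    the indicator of its case. *)
Lemma recursive_if n (b f g : n.-tuple nat -> nat) :
  recursive b -> recursive f -> recursive g ->
  recursive (fun v => if b v == 0 then g v else f v).
Proof.
move=> rb rf rg.
have rb0 := recursive1_comp recursive1_eq0 rb.
have rb1 := recursive1_comp recursive1_eq0 rb0.
have := recursive2_comp recursive2_add (recursive2_comp recursive2_mul rb0 rg)
  (recursive2_comp recursive2_mul rb1 rf).
by apply: eq_recursive => v; case: (b v == 0); rewrite !(mul1n, mul0n, addn0).
Qed.

Lemma computable_if (E T : countType) (b : E -> bool) (f g : E -> T) :
  computable b -> computable f -> computable g ->
  computable (fun e => if b e then f e else g e).
Proof.
move=> /computable_recursive1E[B rB bB] /computable_recursive1E[F rF fF].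
move=> /computable_recursive1E[G rG gG].
apply: (@computable_recursive1 _ _ _ (fun n => if B n == 0 then G n else F n)
  (recursive_if rB rF rG)) => e /=.
by rewrite bB fF gG; case: (b e).
Qed.

(** The empty sequence is the only one with code 0; a zero test decides the case, and [chead] and
    [ctail] recover the components. *)
Lemma computable_case_seq (E T U : countType) (s : E -> seq T)
    (z : E -> U) (f : E -> T -> seq T -> U) :
  computable s -> computable z ->
  computable (fun p : E * (T * seq T) => f p.1 p.2.1 p.2.2) ->
  computable (fun e => if s e is x :: s' then f e x s' else z e).
Proof.
move=> /computable_recursive1E[S rS sS] /computable_recursive1E[Z rZ zZ].
move=> /computable_recursive1E[F rF fF].
have r0 := recursive_const 1 0.
have rc n (g h : n.-tuple nat -> nat) := @recursive2_comp n _ g h recursive2_ccons.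
have rS1 := recursive1_comp recursive1_chead rS.
have rS2 := recursive1_comp recursive1_ctail rS.
have rSF := recursive1_comp rF (rc _ _ _ (recursive_nth 1 0)
  (rc _ _ _ (rc _ _ _ rS1 (rc _ _ _ rS2 r0)) r0)).
apply: (@computable_recursive1 _ _ _ (fun n => if S n == 0 then Z n else
  F (ccons n (ccons (ccons (chead (S n)) (ccons (ctail (S n)) 0)) 0)))
  (recursive_if rS rSF rZ)) => e /=.
rewrite sS zZ; case: (s e) => [|x s'] //=.
rewrite pickle_cons chead_ccons ctail_ccons -[_ == 0]negbK -lt0n ccons_gt0.
exact: (fF (e, (x, s'))).
Qed.

Lemma computable_iter (E T : countType) (n : E -> nat) (f : E -> T -> T)
    (z : E -> T) :
  computable n -> computable (fun p : E * T => f p.1 p.2) -> computable z ->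
  computable (fun e => iter (n e) (f e) (z e)).
Proof.
move=> /computable_recursive1E[N rN nN] /computable_recursive1E[F rF fF].
move=> /computable_recursive1E[Z rZ zZ].
pose h y x := iter y (fun a => F (ccons x (ccons a 0))) (Z x).
have rh : recursive2 h.
  apply: (@recursive2_primrec Z
    (fun v => F (ccons (nth 0 v 2) (ccons (nth 0 v 1) 0)))) => //.
  apply: (recursive1_comp rF); apply: (recursive2_comp recursive2_ccons).
    exact: recursive_nth.
  exact: (recursive2_comp recursive2_ccons (recursive_nth _ _) (recursive_const _ _)).
apply: (@computable_recursive1 _ _ _ (fun m => h (N m) m)
  (recursive2_comp rh rN (recursive_nth 1 0))) => e /=.
rewrite nN /h zZ /pickle /=; elim: (n e) => //= m ->.
exact: (fF (e, _)).
Qed.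

Lemma computable_pickle (E T : countType) (f : E -> T) :
  computable f -> computable (fun e => pickle (f e)).
Proof. by apply: computable_samecode. Qed.

Lemma computable_nat_of_ord (E : countType) n (f : E -> 'I_n) :
  computable f -> computable (fun e => f e : nat).
Proof. by apply: computable_samecode. Qed.

(** Makes the code of a sequence a computable bound on the number of steps needed to traverse it. *)
Lemma size_leq_pickle (T : countType) (s : seq T) : size s <= pickle s.
Proof.
elim: s => //= x s IHs; rewrite pickle_cons; apply: (leq_ltn_trans IHs).
by rewrite /ccons -[(pickle s).+1]mul1n leq_mul ?expn_gt0 // -addnn ltnS leq_addr.
Qed.

(** A fold is an iteration on pairs of remaining sequence and accumulator. It runs [pickle (s e)]
    times; once the sequence is used up, [step] changes nothing. *)
Lemma computable_foldl (E T A : countType) (f : E -> A -> T -> A) (z : E -> A)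
    (s : E -> seq T) :
  computable (fun p : E * (A * T) => f p.1 p.2.1 p.2.2) -> computable z ->
  computable s -> computable (fun e => foldl (f e) (z e) (s e)).
Proof.
move=> cf cz cs.
pose step e (p : seq T * A) :=
  if p.1 is x :: s' then (s', f e p.2 x) else ([::], p.2).
have cstep : computable (fun q : E * (seq T * A) => step q.1 q.2).
  apply: (@computable_case_seq _ _ _ (fun q => q.2.1) (fun q => ([::], q.2.2))
    (fun q x s' => (s', f q.1 q.2.2 x))).
  - exact: (computable_fst (computable_snd (@computable_id _))).
  - apply: computable_pair; first exact: computable_const.
    exact: (computable_snd (computable_snd (@computable_id _))).
  - apply: computable_pair.
      exact: (computable_snd (computable_snd (@computable_id _))).
    have c1 := computable_fst (@computable_id ((E * (seq T * A)) * (T * seq T))%type).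
    have c2 := computable_fst (computable_snd
      (@computable_id ((E * (seq T * A)) * (T * seq T))%type)).
    have c3 := computable_pair (computable_fst c1)
      (computable_pair (computable_snd (computable_snd c1)) c2).
    exact: (computable_comp cf c3).
have := computable_snd
  (computable_iter (computable_pickle cs) cstep (computable_pair cs cz)).
apply: eq_computable => e.
elim: (s e) (pickle _) (z e) (size_leq_pickle (s e)) => [|x s' IH] n a.
  by move=> _ /=; suff -> : iter n (step e) ([::], a) = ([::], a);
    [|elim: n => //= n ->].
by case: n => // n; rewrite ltnS iterSr => /IH ->.
Qed.

Lemma computable_rev (E T : countType) (s : E -> seq T) :
  computable s -> computable (fun e => rev (s e)).
Proof.
move=> cs; have c1 := computable_snd (@computable_id (E * (seq T * T))%type).
have := @computable_foldl _ _ _ (fun=> fun r x => x :: r) (fun=> [::]) s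
   (computable_cons (computable_snd c1) (computable_fst c1)) (computable_const _ _) cs.
apply: eq_computable => e; rewrite -[RHS]cats0 -/(catrev _ _).
by elim: (s e) [::] => //= x s' IH r; rewrite IH rev_cons cat_rcons.
Qed.

Lemma computable_foldr (E T A : countType) (f : E -> T -> A -> A) (z : E -> A)
    (s : E -> seq T) :
  computable (fun p : E * (T * A) => f p.1 p.2.1 p.2.2) -> computable z ->
  computable s -> computable (fun e => foldr (f e) (z e) (s e)).
Proof.
move=> cf cz cs; have c1 := @computable_id (E * (A * T))%type.
have c2 := computable_pair (computable_fst c1) (computable_pair
  (computable_snd (computable_snd c1)) (computable_fst (computable_snd c1))).
have := @computable_foldl _ _ _ (fun e a x => f e x a) _ _
  (computable_comp cf c2) cz (computable_rev cs).
by apply: eq_computable => e; rewrite foldl_rev.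
Qed.

Lemma computable_cat (E T : countType) (s t : E -> seq T) :
  computable s -> computable t -> computable (fun e => s e ++ t e).
Proof.
move=> cs ct; have c1 := computable_snd (@computable_id (E * (T * seq T))%type).
have := @computable_foldr _ _ _ (fun _ x r => x :: r) _ _
  (computable_cons (computable_fst c1) (computable_snd c1)) ct cs.
by apply: eq_computable => e; elim: (s e) => //= x r ->.
Qed.

Lemma computable_map (E T U : countType) (f : E -> T -> U) (s : E -> seq T) :
  computable (fun p : E * T => f p.1 p.2) -> computable s ->
  computable (fun e => [seq f e x | x <- s e]).
Proof.
move=> cf cs; have c1 := @computable_id (E * (T * seq U))%type.
have c2 := computable_comp cf
  (computable_pair (computable_fst c1) (computable_fst (computable_snd c1))).
exact: (@computable_foldr _ _ _ (fun e x r => f e x :: r) _ _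
  (computable_cons c2 (computable_snd (computable_snd c1)))
  (computable_const _ _) cs).
Qed.

Lemma computable_filter (E T : countType) (a : E -> T -> bool) (s : E -> seq T) :
  computable (fun p : E * T => a p.1 p.2) -> computable s ->
  computable (fun e => [seq x <- s e | a e x]).
Proof.
move=> ca cs; have c1 := @computable_id (E * (T * seq T))%type.
have c2 := computable_fst (computable_snd c1).
have c3 := computable_snd (computable_snd c1).
have c4 := computable_comp ca (computable_pair (computable_fst c1) c2).
exact: (@computable_foldr _ _ _ (fun e x r => if a e x then x :: r else r) _ _
  (computable_if c4 (computable_cons c2 c3) c3) (computable_const _ _) cs).
Qed.

Lemma computable_has (E T : countType) (a : E -> T -> bool) (s : E -> seq T) :
  computable (fun p : E * T => a p.1 p.2) -> computable s ->
  computable (fun e => has (a e) (s e)).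
Proof.
move=> ca cs; have c1 := @computable_id (E * (T * bool))%type.
have c4 := computable_comp ca
  (computable_pair (computable_fst c1) (computable_fst (computable_snd c1))).
exact: (@computable_foldr _ _ _ (fun e x b => if a e x then true else b) _ _
  (computable_if c4 (computable_const _ _) (computable_snd (computable_snd c1)))
  (computable_const _ _) cs).
Qed.

Lemma computable_flatten (E T : countType) (s : E -> seq (seq T)) :
  computable s -> computable (fun e => flatten (s e)).
Proof.
move=> cs; have c1 := computable_snd (@computable_id (E * (seq T * seq T))%type).
exact: (@computable_foldr _ _ _ (fun _ => cat) _ _
  (computable_cat (computable_fst c1) (computable_snd c1)) (computable_const _ _) cs).
Qed.

Lemma computable_negb (E : countType) (b : E -> bool) :
  computable b -> computable (fun e => ~~ b e).
Proof. by move=> cb; apply: (computable_if cb); apply: computable_const. Qed.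

Lemma computable_andb (E : countType) (b c : E -> bool) :
  computable b -> computable c -> computable (fun e => b e && c e).
Proof. by move=> cb cc; apply: (computable_if cb) => //; apply: computable_const. Qed.

(** Two numbers are equal iff both truncated differences, obtained by iterating [predn], vanish. *)
Lemma recursive2_eq : recursive2 (fun n m => n == m).
Proof.
have rS n (f g : n.-tuple nat -> nat) (rf : recursive f) (rg : recursive g) :=
  recursive2_comp (recursive2_iter recursive1_pred) rf rg.
have r0 := recursive_nth 2 0; have r1 := recursive_nth 2 1.
have := recursive1_comp recursive1_eq0
  (recursive2_comp recursive2_add (rS _ _ _ r0 r1) (rS _ _ _ r1 r0)).
have iterpred m n : iter m predn n = n - m.
  by elim: m => [|m IH]; rewrite ?subn0 // iterS IH subnS.
by apply: eq_recursive => v; rewrite !iterpred addn_eq0 !subn_eq0 andbC -eqn_leq.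
Qed.

Lemma computable_eq (E T : countType) (f g : E -> T) :
  computable f -> computable g -> computable (fun e => f e == g e).
Proof.
apply: (@computable_op _ _ _ _ (fun x y => x == y) (fun n m => n == m)).
  exact: recursive2_eq.
by move=> x y; rewrite (inj_eq (pcan_inj pickleK)).
Qed.

Lemma computable_iota (E : countType) (n : E -> nat) :
  computable n -> computable (fun e => iota 0 (n e)).
Proof.
move=> cn.
have cS : computable succn by apply: (@computable_recursive1 _ _ _ _ recursive1_succ).
have c1 := computable_snd (@computable_id (E * seq nat * nat)%type).
have cs := computable_cons (computable_const (E * seq nat)%type 0)
  (@computable_map _ _ _ (fun=> succn) _ (computable_comp cS c1)
    (computable_snd (@computable_id (E * seq nat)%type))).
have := @computable_iter _ _ _ (fun _ s => 0 :: map succn s) _ cn cs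
  (computable_const _ [::]).
by apply: eq_computable => e; elim: (n e) => //= m ->; rewrite (iotaDl 1 0).
Qed.

(** A function on a finite type is a finite table, looked up by nested conditionals; this covers
    functions obtained by choice. *)
Lemma computable_finType (T : finType) (U : countType) (f : T -> U) : computable f.
Proof.
pose F s n := foldr (fun x r => if n == pickle x then pickle (f x) else r) 0 s.
apply: (@computable_recursive1 _ _ _ (F (enum T))) => [|x].
  elim: (enum T) => [|x s IH]; first exact: recursive_const.
  have := recursive_if (recursive2_comp recursive2_eq (recursive_nth 1 0)
    (recursive_const 1 (pickle x))) (recursive_const _ (pickle (f x))) IH.
  by apply: eq_recursive => v /=; case: (_ == pickle x).
have: x \in enum T by rewrite mem_enum.
elim: (enum T) => //= y s IH; rewrite inE.
by rewrite (inj_eq (pcan_inj pickleK)); case: eqVneq => [-> //|_ /IH].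
Qed.

Lemma computable_exp2 (E : countType) (n : E -> nat) :
  computable n -> computable (fun e => 2 ^ n e).
Proof.
by apply: computable_comp; apply: (@computable_recursive1 _ _ _ _ recursive1_exp2).
Qed.

(** An alphabet symbol is a bit vector: binary digit [c] of the symbol is the value of track [c]. *)
Definition bit (a c : nat) : bool := odd (iter c half a).

Lemma computable_bit (E : countType) (a c : E -> nat) :
  computable a -> computable c -> computable (fun e => bit (a e) (c e)).
Proof.
apply: (@computable_op _ _ _ _ bit (fun a c => bit a c)) => //.
apply: (recursive1_comp recursive1_odd).
exact: (recursive2_comp (recursive2_iter recursive1_half)
  (recursive_nth _ _) (recursive_nth _ _)).
Qed.

(* The pattern [fun _ => ?c] must not be written [fun e => ?c], which also
   matches bodies that depend on [e]. Conditionals, which Ltac cannot match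
   second-order, are what is left after all the applications. *)
Ltac computability_step :=
  cbv beta;
  lazymatch goal with |- @computable _ _ ?F =>
  lazymatch F with
  | fun e => e => exact: computable_id
  | fun _ => ?c => exact: computable_const
  | fun e => (@?f e, @?g e) => refine (@computable_pair _ _ _ f g _ _)
  | fun e => (@?f e).1 => refine (@computable_fst _ _ _ f _)
  | fun e => (@?f e).2 => refine (@computable_snd _ _ _ f _)
  | fun e => @?f e :: @?g e => refine (@computable_cons _ _ f g _ _)
  | fun e => @?f e ++ @?g e => refine (@computable_cat _ _ f g _ _)
  | fun e => flatten (@?f e) => refine (@computable_flatten _ _ f _)
  | fun e => rev (@?f e) => refine (@computable_rev _ _ f _)
  | fun e => ~~ @?f e => refine (@computable_negb _ f _)
  | fun e => @?f e && @?g e => refine (@computable_andb _ f g _ _)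
  | fun e => @?f e == @?g e => refine (@computable_eq _ _ f g _ _)
  | fun e => 2 ^ @?f e => refine (@computable_exp2 _ f _)
  | fun e => iota 0 (@?f e) => refine (@computable_iota _ f _)
  | fun e => bit (@?f e) (@?g e) => refine (@computable_bit _ f g _ _)
  | fun e => pickle (@?f e) => refine (@computable_pickle _ _ f _)
  | fun e => nat_of_ord (@?f e) => refine (@computable_nat_of_ord _ _ f _)
  | fun e => map (@?f e) (@?s e) => refine (@computable_map _ _ _ f s _ _)
  | fun e => filter (@?f e) (@?s e) => refine (@computable_filter _ _ f s _ _)
  | fun e => has (@?f e) (@?s e) => refine (@computable_has _ _ f s _ _)
  | fun e => foldr (@?f e) (@?z e) (@?s e) =>
      refine (@computable_foldr _ _ _ f z s _ _ _)
  | snd => exact: (computable_snd (@computable_id _))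
  | fst => exact: (computable_fst (@computable_id _))
  | fun e => ?h (@?f e) => refine (@computable_comp _ _ _ h f _ _)
  | fun e => @?g e => refine (computable_if _ _ _)
  | _ => first [assumption | exact: computable_finType]
  end end.

Ltac computability := repeat computability_step.

(** * The constraints and forbidden patterns built from an instance of k-SAT *)

Definition subst_word n m (f : 'I_n * bool -> word m) (w : word n) : word m :=
  flatten [seq f l | l <- w].

Definition inv_word n (w : word n) : word n := rev [seq (l.1, ~~ l.2) | l <- w].

Lemma computable_subst_word n m (f : 'I_n * bool -> word m) :
  computable (subst_word f).
Proof. by rewrite /subst_word; computability. Qed.

Lemma computable_inv_word n : computable (@inv_word n).
Proof. by rewrite /inv_word; computability. Qed.

Section Reduction.
Variables (n0 n1 n2 : nat).
Variables (to0 : 'I_n1 * bool -> word n0) (to2 : 'I_n1 * bool -> word n2).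
Variables (i0 : 'I_n2) (d : word n0 * seq (word n0) -> bool).

Local Notation literal := (bool * (bool * nat))%type.
Local Notation constraint := ('I_n2 * seq (bool * (bool * nat)))%type.

(* The bit beta_v(g u) stored at g. *)
Definition track (v : word n1) (u : word n2) : nat := pickle (v, u).

(* A constraint [(i, C)] is a clause C to be satisfied at every edge from g to
   [g * tnth S i]; a literal [(b, (false, t))] of C says that track t at g is b,
   and [(b, (true, t))] that track t at [g * tnth S i] is b. *)
Definition equate (i : 'I_n2) (p q : bool * nat) : seq constraint :=
  [:: (i, [:: (true, p); (false, q)]); (i, [:: (false, p); (true, q)])].

(** Constraints only follow generators forwards. For an inverse letter the edge is therefore read
    from its other end, with the longer track at the target and the shorter one at the source. *)
Definition edge (v : word n1) (l : 'I_n2 * bool) (r : word n2) :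
    seq constraint :=
  equate l.1 (l.2, track v (l :: r)) (~~ l.2, track v r).

(** The fold carries the suffix read so far next to the constraints, because the edge of a letter
    mentions the word after it. *)
Definition edges (v : word n1) (u : word n2) : seq constraint :=
  (foldr (fun l (p : word n2 * seq constraint) =>
            (l :: p.1, edge v l p.1 ++ p.2)) ([::], [::]) u).2.

(** The word for v v'^-1 is rewritten twice: by [to0] for the membership oracle, and by [to2] to be
    followed in the domino graph. *)
Definition link (ws : seq (word n1)) (v v' : word n1) : seq constraint :=
  let u := v ++ inv_word v' in
  if d (subst_word to0 u, [seq subst_word to0 w | w <- ws]) then
    equate i0 (false, track v [::]) (false, track v' (subst_word to2 u)) ++
    edges v' (subst_word to2 u)
  else [::].

(* The generator [i0] plays no role here: any edge leaving g sees the tracks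
   at g. *)
Definition local_clause (C : seq (bool * word n1)) : constraint :=
  (i0, [seq (l.1, (false, track l.2 [::])) | l <- C]).

Definition variables (phi : seq (seq (bool * word n1))) : seq (word n1) :=
  [seq l.2 | l <- flatten phi].

Definition constraints (phi : seq (seq (bool * word n1))) (ws : seq (word n1)) :
    seq constraint :=
  [seq local_clause C | C <- phi] ++
  flatten [seq flatten [seq link ws v v' | v' <- variables phi]
          | v <- variables phi].

Lemma computable_constraints :
  computable d ->
  computable (fun I : seq (seq (bool * word n1)) * seq (word n1) =>
                constraints I.1 I.2).
Proof.
move=> cd; rewrite /constraints /link /local_clause /variables /edges /edge
  /equate /track.
have c0 := computable_subst_word to0.
have c2 := computable_subst_word to2.
have cV := @computable_inv_word n1.
computability.
Qed.

Definition holds (a b : nat) (l : literal) : bool :=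
  bit (if l.2.1 then b else a) l.2.2 == l.1.

Definition forbidden (cs : seq constraint) (p : nat * nat * nat) : bool :=
  has (fun c : constraint =>
    (c.1 == p.2 :> nat) && ~~ has (holds p.1.1 p.1.2) c.2) cs.

Definition tracks (cs : seq constraint) : seq nat :=
  [seq l.2.2 | l <- flatten [seq c.2 | c <- cs]].

(* Every track is smaller than [pickle (tracks cs)]. *)
Definition alphabet (cs : seq constraint) : nat := 2 ^ pickle (tracks cs).

(** Patterns over plain numbers, which keeps the computation free of the dependent type of domino
    instances; [pickle_domino_of] transfers it. *)
Definition pattern_list (cs : seq constraint) : seq (nat * nat * nat) :=
  [seq p <- flatten [seq flatten [seq [seq (a, b, i) | i <- iota 0 n2]
                                 | b <- iota 0 (alphabet cs)]
                    | a <- iota 0 (alphabet cs)] | forbidden cs p].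

Lemma computable_pattern_list : computable (fun cs => (alphabet cs, pattern_list cs)).
Proof.
rewrite /pattern_list /alphabet /tracks /forbidden /holds.
computability.
Qed.
End Reduction.

(** * Constraints as domino instances *)

Section DominoOfConstraints.
Variable n : nat.
Implicit Types cs : seq ('I_n * seq (bool * (bool * nat))).

Definition pattern_code a (p : 'I_a * 'I_a * 'I_n) : nat * nat * nat :=
  (p.1.1 : nat, p.1.2 : nat, p.2 : nat).

Definition domino_of cs : domino_instance n :=
  @Tagged nat (alphabet cs) (fun a => seq ('I_a * 'I_a * 'I_n))
    [seq p <- flatten [seq flatten [seq [seq (a, b, i) | i <- enum 'I_n]
                                   | b <- enum 'I_(alphabet cs)]
                      | a <- enum 'I_(alphabet cs)]
    | forbidden cs (pattern_code p)].

Lemma pickle_domino_of cs :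
  pickle (domino_of cs) = pickle (alphabet cs, pattern_list cs).
Proof.
rewrite !pickle_pair; set P := tagged (domino_of cs).
rewrite [LHS](_ : _ = ccons (alphabet cs) (ccons (pickle P) 0)) //.
congr (ccons _ (ccons _ 0)); rewrite /pickle /= /pickle_seq.
suff -> : pattern_list cs = map (@pattern_code _) P by rewrite -map_comp.
rewrite /P /= -filter_map /pattern_list; congr filter.
rewrite -(val_enum_ord n) -(val_enum_ord (alphabet cs)) map_flatten -!map_comp.
congr flatten; apply: eq_map => a /=; rewrite map_flatten -!map_comp; congr flatten.
by apply: eq_map => b /=; rewrite -!map_comp.
Qed.

Lemma mem_domino_of cs p :
  (p \in tagged (domino_of cs)) = forbidden cs (pattern_code p).
Proof.
rewrite mem_filter andb_idr // => _; case: p => [[a b] i].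
apply/flatten_mapP; exists a; rewrite ?mem_enum //.
apply/flatten_mapP; exists b; rewrite ?mem_enum //.
by apply: map_f; rewrite mem_enum.
Qed.

Fixpoint of_bits (f : nat -> bool) m : nat :=
  if m is m'.+1 then f 0 + (of_bits (fun t => f t.+1) m').*2 else 0.

Lemma ltn_of_bits f m : of_bits f m < 2 ^ m.
Proof.
elim: m f => //= m IH f; rewrite expnS mul2n.
apply: (@leq_trans (of_bits (fun t => f t.+1) m).+1.*2); last by rewrite leq_double.
by rewrite doubleS ltnS; case: (f 0).
Qed.

Lemma bit_of_bits f m t : t < m -> bit (of_bits f m) t = f t.
Proof.
elim: m t f => // m IH [|t] f; rewrite /bit.
  by rewrite /= oddD odd_double addbF; case: (f 0).
by rewrite ltnS iterSr /= half_bit_double => /IH; apply.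
Qed.

Definition constraint_holds (G : groupType) (S : n.-tuple G) (y : G -> nat -> bool)
    (g : G) (c : 'I_n * seq (bool * (bool * nat))) : bool :=
  has (fun l => y (if l.2.1 then (g * tnth S c.1)%g else g) l.2.2 == l.1) c.2.

(** Symbols and families of bits determine each other as far as the constraints can see: cutting a
    family down to [pickle (tracks cs)] bits keeps every track that occurs. *)
Lemma domino_ofP (G : groupType) (S : n.-tuple G) cs :
  domino S (domino_of cs) <->
  exists y, forall g c, c \in cs -> constraint_holds S y g c.
Proof.
split=> [[x xP]|[y yP]].
  exists (fun g => bit (x g)) => g c c_cs; apply: contraT => notc.
  case: (xP (x g, x (g * tnth S c.1)%g, c.1)); last by exists g.
  rewrite mem_domino_of; apply/hasP; exists c => //=; rewrite eqxx /=.
  by apply: contra notc; apply: sub_has => l; rewrite /holds /=; case: l.2.1.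
exists (fun g => Ordinal (ltn_of_bits (y g) (pickle (tracks cs)))) => p.
rewrite mem_domino_of => /hasP[c c_cs /andP[/eqP/val_inj c1 /negP notc]].
case=> g [/(congr1 val) /= xa /(congr1 val) /= xb]; apply: notc.
have /hasP[l lc ly] := yP g c c_cs; apply/hasP; exists l => //.
have lt_l : l.2.2 < pickle (tracks cs).
  (* The code of a sequence of numbers exceeds each of its entries. *)
  apply: (allP (CodeSeq.ltn_code (map pickle (tracks cs)))).
  apply: (map_f (@pickle nat)).
  apply: (map_f (fun l : bool * (bool * nat) => l.2.2)).
  by apply/flatten_mapP; exists c.
by move: ly; rewrite /holds /= -xa -xb c1; case: l.2.1; rewrite bit_of_bits.
Qed.

End DominoOfConstraints.
Local Open Scope group_scope.

(** * Generated subgroups and evaluation of words *)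

Lemma is_subgroup_generated (G : groupType) (X : set G) :
  is_subgroup (generated X).
Proof.
split=> [K [[K1 KM KV] XK]|x y Kx Ky K KX|x Kx K KX] //.
  by have [[_ KM _] _] := KX; apply: KM; [apply: Kx | apply: Ky].
by have [[_ _ KV] _] := KX; apply: KV; apply: Kx.
Qed.

Section Words.
Variables (G : groupType) (n : nat) (S : n.-tuple G).

Lemma eval_word_nil : eval_word S [::] = 1.
Proof. exact: big_nil. Qed.

Lemma eval_word_cons l w : eval_word S (l :: w) = eval_letter S l * eval_word S w.
Proof. exact: big_cons. Qed.

Lemma eval_word_cat u w : eval_word S (u ++ w) = eval_word S u * eval_word S w.
Proof. exact: big_cat. Qed.

Lemma eval_inv_word w : eval_word S (inv_word w) = (eval_word S w)^-1.
Proof.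
elim: w => [|l w IH]; first by rewrite eval_word_nil invg1.
rewrite /inv_word map_cons rev_cons -cats1 eval_word_cat IH !eval_word_cons.
rewrite invgM eval_word_nil mulg1; congr (_ * _).
by rewrite /eval_letter /=; case: l.2; rewrite ?invgK.
Qed.

(** The values of words form a subgroup containing [S], so minimality of the generated subgroup
    applies. *)
Lemma generating_word (g : G) : generating S -> exists w, eval_word S w = g.
Proof.
move=> genS; have : generated [set x | x \in S]%classic g by rewrite genS.
move/(_ [set x | exists w, eval_word S w = x]%classic); apply.
split; last first.
  move=> _ /tnthP[i ->]; exists [:: (i, false)].
  by rewrite eval_word_cons eval_word_nil mulg1.
split=> [|_ _ [u <-] [w <-]|_ [w <-]].
- by exists [::]; rewrite eval_word_nil.
- by exists (u ++ w); rewrite eval_word_cat.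
- by exists (inv_word w); rewrite eval_inv_word.
Qed.

End Words.

Lemma eval_subst_word (G : groupType) n m (S : n.-tuple G) (T : m.-tuple G)
    (f : 'I_m * bool -> word n) w :
  (forall l, eval_word S (f l) = eval_letter T l) ->
  eval_word S (subst_word f w) = eval_word T w.
Proof.
move=> fE; elim: w => [|l w IH]; first by rewrite !eval_word_nil.
by rewrite eval_word_cons -fE -IH -eval_word_cat.
Qed.

Lemma generating_rewriting (G : groupType) n m (S : n.-tuple G) (T : m.-tuple G) :
  generating S ->
  exists f : 'I_m * bool -> word n,
    forall l, eval_word S (f l) = eval_letter T l.
Proof.
move=> genS.
have /boolp.choice[f fE] : forall l, exists w, eval_word S w = eval_letter T l.
  by move=> l; exact: generating_word.
by exists f.
Qed.

(** Without letters only the empty word exists, and the group would be trivial. This supplies the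
    generator [i0]. *)
Lemma generating_gt0 (G : groupType) n (S : n.-tuple G) :
  infinite_set [set: G]%classic -> generating S -> (0 < n)%N.
Proof.
case: n S => // S infG genS; case: infG.
rewrite (_ : [set: G]%classic = [set 1]%classic); first exact: finite_set1.
apply/seteqP; split=> // g _; have [w <-] := generating_word g genS.
by case: w => [|[[]]] //; rewrite eval_word_nil.
Qed.

(** * What the constraints say about tracks *)

Section Equations.
Variables (G : groupType) (n1 n : nat) (S : n.-tuple G) (y : G -> nat -> bool).
Local Notation holds_everywhere cs :=
  (forall g c, c \in cs -> constraint_holds S y g c).

Lemma equateP i (p q : bool * nat) :
  holds_everywhere (equate i p q) <->
  forall g, y (if p.1 then g * tnth S i else g) p.2 =
            y (if q.1 then g * tnth S i else g) q.2.
Proof.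
split=> [H g|H g c]; last first.
  by rewrite !inE => /orP[] /eqP ->; rewrite /constraint_holds /= H; case: (y _ _).
have := H g _ (mem_head _ _); have := H g (i, [:: (false, p); (true, q)]).
rewrite !inE eqxx orbT => /(_ isT); rewrite /constraint_holds /=.
by case: (y _ _); case: (y _ _).
Qed.

Lemma edgeP (v : word n1) (l : 'I_n * bool) (r : word n) :
  holds_everywhere (edge v l r) <->
  forall g, y g (track v (l :: r)) = y (g * eval_letter S l) (track v r).
Proof.
rewrite /edge equateP /eval_letter /=; case: l => i [] //=.
split=> H g; last by rewrite H mulgK.
(* For an inverse letter the constraint is based at g s^-1, so g is written as (g s^-1) s. *)
by rewrite -[in LHS](mulgVK (tnth S i) g) H.
Qed.

Lemma edges_cons (v : word n1) l (r : word n) :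
  edges v (l :: r) = edge v l r ++ edges v r.
Proof.
rewrite /edges /=; congr (edge _ _ _ ++ _).
by elim: r => //= a r ->.
Qed.

(** Each edge removes the first letter of the word and moves the base point along it, until the
    empty word remains. *)
Lemma edges_track (v : word n1) (u : word n) :
  holds_everywhere (edges v u) ->
  forall g, y g (track v u) = y (g * eval_word S u) (track (n2 := n) v [::]).
Proof.
elim: u => [|l r IH] H g; first by rewrite eval_word_nil mulg1.
rewrite edges_cons in H; rewrite eval_word_cons mulgA -IH; last first.
  by move=> h c cr; apply: H; rewrite mem_cat cr orbT.
by apply/(edgeP v l r): g => g c cl; apply: H; rewrite mem_cat cl.
Qed.

Lemma track_edges (v : word n1) (u : word n) :
  (forall l r g, y g (track v (l :: r)) = y (g * eval_letter S l) (track v r)) ->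
  holds_everywhere (edges v u).
Proof.
move=> H; elim: u => // l r IH g c; rewrite edges_cons mem_cat => /orP[|/IH //].
by move: g c; apply/edgeP.
Qed.

End Equations.

(** * Correctness of the reduction *)

Section Correctness.
Variables (G : groupType) (n0 n1 n2 : nat).
Variables (S0 : n0.-tuple G) (S1 : n1.-tuple G) (S2 : n2.-tuple G).
Variables (to0 : 'I_n1 * bool -> word n0) (to2 : 'I_n1 * bool -> word n2).
Hypothesis to0E : forall l, eval_word S0 (to0 l) = eval_letter S1 l.
Hypothesis to2E : forall l, eval_word S2 (to2 l) = eval_letter S1 l.
Variables (i0 : 'I_n2) (d : word n0 * seq (word n0) -> bool).
Hypothesis dP : forall I, subgroup_membership S0 I <-> d I.
Variables (phi : seq (seq (bool * word n1))) (ws : seq (word n1)).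

Local Notation H := (generated_by_words S1 ws).
Local Notation ev1 := (eval_word S1).
Local Notation ev2 := (eval_word S2).
Local Notation main_track v := (@track n1 n2 v [::]).
Local Notation cs := (constraints to0 to2 i0 d phi ws).

Lemma membershipP (u : word n1) :
  d (subst_word to0 u, [seq subst_word to0 w | w <- ws]) <-> H (ev1 u).
Proof.
rewrite -dP /subgroup_membership /= /generated_by_words -map_comp.
rewrite (eq_map (g := ev1)) => [|w /=]; last exact: eval_subst_word.
by rewrite (eval_subst_word _ to0E).
Qed.

Lemma mem_constraints c :
  reflect ((exists2 C, C \in phi & c = local_clause i0 C) \/
           exists v v', [/\ v \in variables phi, v' \in variables phi
                          & c \in link to0 to2 i0 d ws v v'])
    (c \in cs).
Proof.
rewrite mem_cat; apply: (iffP orP) => [[/mapP|]|[/mapP|]]; try by left.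
  by move=> /flatten_mapP[v vP /flatten_mapP[v' v'P cP]]; right; exists v, v'.
move=> [v [v' [vP v'P cP]]]; right.
by apply/flatten_mapP; exists v => //; apply/flatten_mapP; exists v'.
Qed.

Lemma mem_variables C l : C \in phi -> l \in C -> l.2 \in variables phi.
Proof.
by move=> Cphi lC; apply: map_f; apply/flattenP; exists C.
Qed.

(** The solution on H is copied to each left coset gH by pulling g back to [(rep g)^-1 * g], an
    element of H, where [rep] chooses one point per coset. *)
Lemma constraints_of_assignment (alpha : G -> bool) :
  (forall h, H h -> forall C, C \in phi ->
     has (fun l => alpha (h * ev1 l.2) == l.1) C) ->
  exists y, forall g c, c \in cs -> constraint_holds S2 y g c.
Proof.
move=> alphaP.
have [H1 HM HV] := is_subgroup_generated [set x | x \in map ev1 ws]%classic.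
pose rep (g : G) := xget 1 [set x | H (x^-1 * g)]%classic.
have repP g : H ((rep g)^-1 * g).
  rewrite /rep; apply: (@xgetPex _ 1 [set x | H (x^-1 * g)]%classic).
  by exists g; rewrite /= mulVg.
(* As g H = g u H, the choice is made from the same set both times. *)
have repM g u : H u -> rep (g * u) = rep g.
  move=> Hu; rewrite /rep; congr xget; apply/seteqP; split=> x /=.
    by move=> /HM/(_ (HV _ Hu)); rewrite mulgA mulgK.
  by rewrite mulgA => /HM; apply.
pose beta v g := alpha ((rep g)^-1 * g * ev1 v).
pose y g c := if unpickle c is Some (v, u) then beta v (g * ev2 u) else false.
have yE g v u : y g (track v u) = beta v (g * ev2 u).
  by rewrite /y /track pickleK.
exists y => g c /mem_constraints[[C Cphi ->]|].
  have /hasP[l lC lP] := alphaP _ (repP g) _ Cphi.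
  apply/hasP; exists (l.1, (false, main_track l.2)).
    by apply/mapP; exists l.
  by rewrite /= yE eval_word_nil mulg1.
case=> [v [v' [_ _]]]; rewrite /link; case: ifP => // /membershipP.
rewrite eval_word_cat eval_inv_word => Hu; rewrite mem_cat => /orP[].
  (* With u = v v'^-1 in H, the elements g and g u share their representative, and u v' = v gives
     beta_v'(g u) = beta_v(g). *)
  move: g c; apply/equateP => g /=; rewrite !yE eval_word_nil mulg1.
  rewrite (eval_subst_word _ to2E) eval_word_cat eval_inv_word /beta repM //.
  by rewrite -!mulgA mulVg mulg1.
move: g c; apply: track_edges => l r g.
by rewrite !yE eval_word_cons mulgA.
Qed.

(** The value at x is read off any factorization x = h v with h in H and v a variable; the links
    make it independent of the factorization. *)
Lemma assignment_of_constraints (y : G -> nat -> bool) :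
  (forall g c, c \in cs -> constraint_holds S2 y g c) ->
  exists alpha : G -> bool, forall h, H h -> forall C, C \in phi ->
    has (fun l => alpha (h * ev1 l.2) == l.1) C.
Proof.
move=> yP.
have [H1 HM HV] := is_subgroup_generated [set x | x \in map ev1 ws]%classic.
pose P x h v := [/\ H h, v \in variables phi, x = h * ev1 v & y h (main_track v)].
(* Points without a factorization get the value false; no translated clause mentions them. *)
pose alpha x := `[< exists h v, P x h v >].
have alphaE h v :
    H h -> v \in variables phi -> alpha (h * ev1 v) = y h (main_track v).
  move=> Hh vphi; apply/asboolP/idP => [|yh]; last by exists h, v.
  case=> [h' [v' [Hh' v'phi hE yh']]].
  (* From h v = h' v' it follows that v v'^-1 = h^-1 h' lies in H, so the pair (v, v') is linked. *)
  have uE : ev1 (v ++ inv_word v') = h^-1 * h'.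
    rewrite eval_word_cat eval_inv_word.
    by apply: (mulgI h); rewrite mulgA hE mulgK mulVKg.
  have Hu : d (subst_word to0 (v ++ inv_word v'), [seq subst_word to0 w | w <- ws]).
    by apply/membershipP; rewrite uE; apply: HM => //; apply: HV.
  have linkP g c : c \in link to0 to2 i0 d ws v v' -> constraint_holds S2 y g c.
    by move=> cP; apply: yP; apply/mem_constraints; right; exists v, v'.
  rewrite /link Hu in linkP.
  (* The main track of v at h equals the track (v', u) at h, which the edges carry to the main track
     of v' at h u = h'. *)
  have /equateP/(_ h)/= -> : forall g c,
      c \in equate i0 (false, main_track v)
        (false, track v' (subst_word to2 (v ++ inv_word v'))) ->
    constraint_holds S2 y g c by move=> g c cP; apply: linkP; rewrite mem_cat cP.
  rewrite (edges_track (S := S2)) => [|g c cP]; last first.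
    by apply: linkP; rewrite mem_cat cP orbT.
  by rewrite (eval_subst_word _ to2E) uE mulVKg.
exists alpha => h Hh C Cphi.
have /hasP[_ /mapP[l lC ->] lP] : constraint_holds S2 y h (local_clause i0 C).
  by apply: yP; apply/mem_constraints; left; exists C.
apply/hasP; exists l => //; rewrite alphaE //; exact: mem_variables lC.
Qed.

End Correctness.

Lemma satisfies_translateE (G : groupType) k n (S : n.-tuple G)
    (phi : formula k (word n)) (alpha : G -> bool) h :
  satisfies alpha (translate h (map_formula (eval_word S) phi)) <->
  forall C, C \in map val phi ->
    has (fun l => alpha (h * eval_word S l.2) == l.1) C.
Proof.
rewrite /satisfies /translate /map_formula !all_map.
split=> [/allP satP _ /mapP[C Cphi ->]|hasP].
  by have := satP C Cphi; rewrite /= !has_map.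
by apply/allP => C Cphi; rewrite /= !has_map; apply: hasP (map_f _ Cphi).
Qed.

Theorem lemma25 (G : groupType)
    (n0 : nat) (S0 : n0.-tuple G) (n1 : nat) (S1 : n1.-tuple G)
    (n2 : nat) (S2 : n2.-tuple G)
    (infG : infinite_set (@setT G))
    (genS0 : generating S0) (genS1 : generating S1) (genS2 : generating S2)
    (decG : decidable_problem (subgroup_membership S0))
    (k : nat) (hk : (2 <= k)%N) :
  many_one (kSAT k S1) (domino S2).
Proof.
have [to0 to0E] := generating_rewriting S1 genS0.
have [to2 to2E] := generating_rewriting S1 genS2.
have [d cd dP] := decG.
pose i0 := Ordinal (generating_gt0 infG genS2).
pose clauses (phi : formula k (word n1)) := map val phi.
exists (fun I => domino_of (constraints to0 to2 i0 d (clauses I.1) I.2)).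
  apply: computable_samecode (fun I => esym (pickle_domino_of _)) _.
  have c_val : computable (fun I : formula k (word n1) * seq (word n1) =>
      (clauses I.1, I.2)).
    (* A tuple has the code of its underlying sequence, so forgetting clause lengths is the identity
       on codes. *)
    apply: (@computable_samecode _ _ _ id); last exact: computable_id.
    case=> phi ws; rewrite !pickle_pair; congr (ccons _ _).
    by rewrite /clauses /pickle /= /pickle_seq -map_comp.
  have := computable_comp (computable_constraints to0 to2 i0 cd) c_val.
  exact: (computable_comp (@computable_pattern_list n2)).
move=> [phi ws]; rewrite domino_ofP; split=> [[alpha alphaP]|[y yP]].
  apply: (constraints_of_assignment to0E to2E i0 dP (alpha := alpha)) => h Hh.
  by apply/satisfies_translateE; apply: alphaP.
have [alpha alphaP] := assignment_of_constraints to0E to2E dP yP.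
by exists alpha => h Hh; apply/satisfies_translateE; apply: alphaP.
Qed.
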